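(* Let $k$ be a field, $n\ge1$ an integer, $S=k[x_1,\ldots,x_n]$ the standard graded polynomial ring, and let $T=(\tau_0,\tau_1,\tau_2,\ldots)$ be a coherent fractal growth with $\tau_0=(n)$. For each $d\ge 0$ let $I(T)_d\subseteq S_d$ be the $k$-vector space spanned by the monomials $X_a^{(d)}$ with $|\tau_d|<a\le\binom{n+d-1}{d}$. Then $I(T):=\bigoplus_{d} I(T)_d\subseteq S$ is a lex segment ideal (with respect to the lexicographic order induced by $x_1<x_2<\cdots<x_n$), and $H_{S/I(T)}(d)=|\tau_d|$ for every $d\ge 0$.
   Context: **Expansions and coherent fractal growths.** For a positive integer $a$ let $[a]=(1,2,\ldots,a)$. For a sequence of positive integers $\sigma=(s_1,s_2,\ldots)$ let $[\sigma]$ be the concatenation of $[s_1],[s_2],\ldots$ in this order (empty if $\sigma$ is empty). $|\sigma|$ denotes the number of entries of a finite sequence. A (possibly empty) sequence $\tau$ is a truncation of $\sigma$ if $|\tau|\le|\sigma|$ and $\tau(j)=\sigma(j)$ for all $j\le|\tau|$. $T=(\tau_0,\tau_1,\tau_2,\ldots)$ is a coherent fractal growth if $\tau_0=(n)$ and $\tau_j$ is a truncation of $[\tau_{j-1}]$ for each $j\ge1$. **Fractal coefficients.** Convention: $\binom{a}{b}=0$ if $a<b$. For a positive integer $d$, every positive integer $a$ can be written uniquely as $a=\binom{k_d}{d}+\binom{k_{d-1}}{d-1}+\cdots+\binom{k_2}{2}+\binom{k_1}{1}$ with $k_d>k_{d-1}>\cdots>k_2\ge k_1\ge1$. The $d$-fractal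 coefficients of $a$ are $[a]^{(d)}=(c_d,c_{d-1},\ldots,c_1)$ with $c_j=k_j-j+2$ for $2\le j\le d$ and $c_1=k_1$; this is a non-increasing tuple of positive integers. **Monomials.** For $d\ge1$ and $1\le a\le\binom{n+d-1}{d}$ put $X_a^{(d)}=x_{c_1}x_{c_2}\cdots x_{c_d}$, where $[a]^{(d)}=(c_d,\ldots,c_1)$; for $d=0$ put $X_1^{(0)}=1$. **Lex segment ideals and Hilbert function.** A lex segment ideal is a monomial ideal $I$ such that, for every $d$, if $u\in I$ and $v$ are monomials of degree $d$ with $v>_{lex}u$, then $v\in I$. For a homogeneous ideal $I$, $H_{S/I}(d)=\dim_k S_d-\dim_k I_d$. *)

(* Defs.v *)
From HB Require Import structures.
From mathcomp Require Import all_boot all_order all_algebra zify.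
From mathcomp Require Export mpoly.

Set Implicit Arguments.
Unset Strict Implicit.
Unset Printing Implicit Defensive.

Import GRing.Theory.

(** * Coherent fractal growths *)

Definition expansion (s : seq nat) : seq nat :=
  flatten [seq iota 1 a | a <- s].

Definition coherent_fractal_growth (n : nat) (T : nat -> seq nat) : Prop :=
  T 0 = [:: n] /\ forall j, prefix (T j.+1) (expansion (T j)).

(** * Fractal coefficients *)

(* [cascade d a s]: for [s = [:: k_1; ...; k_d]] (increasing indices),
   a = 'C(k_d, d) + ... + 'C(k_1, 1) and k_d > ... > k_2 >= k_1 >= 1. *)
Definition cascade (d a : nat) (s : seq nat) : bool :=
  let k j := nth 0 s j.-1 in
  [&& size s == d,
      a == \sum_(1 <= j < d.+1) 'C(k j, j),
      1 <= k 1,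
      (2 <= d) ==> (k 1 <= k 2)
    & all (fun j => k j < k j.+1) (index_iota 2 d)].

(* Existence and uniqueness: lowering k_1 by one turns a cascade of [a] into a strictly
   increasing binomial expansion of [a.-1]. *)
Definition binsum (s : seq nat) := \sum_(i < size s) 'C(nth 0 s i, i.+1).

Lemma binsum_rcons s x : binsum (rcons s x) = binsum s + 'C(x, (size s).+1).
Proof.
rewrite /binsum size_rcons big_ord_recr /= nth_rcons ltnn eqxx; congr (_ + _).
by apply: eq_bigr => i _; rewrite nth_rcons ltn_ord.
Qed.

Lemma sorted_rconsE s x : sorted ltn (rcons s x) = sorted ltn s && all (gtn x) s.
Proof.
rewrite -cats1 !(sorted_pairwise ltn_trans) pairwise_cat /= allrel1r andbT.
by rewrite andbC.
Qed.

Lemma binsum_exists d N M : N < 'C(M, d) ->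
  exists s, [/\ size s = d, binsum s = N, sorted ltn s & all (gtn M) s].
Proof.
elim: d N M => [|d IH] N M.
  rewrite bin0 ltnS leqn0 => /eqP ->; exists [::].
  by split=> //; rewrite /binsum big_ord0.
move=> ltNM.
have exk : exists k, 'C(k, d.+1) <= N by exists 0; rewrite bin0n.
have bk k : 'C(k, d.+1) <= N -> k <= M.
  move=> lek; rewrite leqNgt; apply/negP => ltMk.
  by have := leq_bin2l d.+1 (ltnW ltMk); lia.
case: (ex_maxnP exk bk) => k lekN maxk.
have ltkM : k < M.
  rewrite ltn_neqAle (bk _ lekN) andbT; apply/eqP => ekM; move: lekN ltNM.
  by rewrite ekM; lia.
have ltN : N < 'C(k.+1, d.+1).
  by rewrite ltnNge; apply/negP => /maxk; rewrite ltnn.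
have [|s [szs sums ss alls]] := IH (N - 'C(k, d.+1)) k.
  by move: ltN; rewrite binS; lia.
exists (rcons s k); split.
- by rewrite size_rcons szs.
- by rewrite binsum_rcons sums szs; lia.
- by rewrite sorted_rconsE ss.
- rewrite all_rcons /= ltkM; apply: sub_all alls => x /=; lia.
Qed.

Lemma binsum_lt s M : sorted ltn s -> all (gtn M) s -> binsum s < 'C(M, size s).
Proof.
elim/last_ind: s M => [|s x IH] M; first by rewrite /binsum big_ord0 bin0.
rewrite sorted_rconsE all_rcons => /andP[ss sx] /= /andP[xM _].
rewrite binsum_rcons size_rcons.
have := leq_bin2l (size s).+1 xM; rewrite binS.
by have := IH _ ss sx; lia.
Qed.

Lemma binsum_inj s t : size s = size t -> sorted ltn s -> sorted ltn t ->
  binsum s = binsum t -> s = t.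
Proof.
elim/last_ind: s t => [|s x IH] t; first by case: t.
case/lastP: t => [|t y]; first by rewrite size_rcons.
rewrite !size_rcons => -[est] Ss St.
have hlt u z : sorted ltn (rcons u z) ->
    'C(z, (size u).+1) <= binsum (rcons u z) < 'C(z.+1, (size u).+1).
  move=> Su; rewrite -[X in _ < 'C(_, X)](size_rcons u z) binsum_lt //.
    by rewrite binsum_rcons leq_addl.
  rewrite all_rcons /= ltnSn; move: Su; rewrite sorted_rconsE => /andP[_].
  by apply: sub_all => w /=; lia.
move=> e; have exy : x = y.
  have /andP[hs1 hs2] := hlt _ _ Ss; have /andP[ht1 ht2] := hlt _ _ St.
  rewrite e est in hs1 hs2.
  case: (ltngtP x y) => // lxy.
    by have := leq_bin2l (size t).+1 lxy; lia.
  by have := leq_bin2l (size t).+1 lxy; lia.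
move: e Ss St; rewrite exy !binsum_rcons est !sorted_rconsE => /addIn e.
by move=> /andP[Ss _] /andP[St _]; rewrite (IH _ est Ss St e).
Qed.

Lemma cascade_lower d a s : cascade d.+1 a s =
  [&& size s == d.+1, 0 < head 0 s, a == (binsum (set_nth 0 s 0 (head 0 s).-1)).+1
    & sorted ltn (set_nth 0 s 0 (head 0 s).-1)].
Proof.
case: s => [|x s]; first by rewrite /cascade /=.
rewrite /cascade /= eqSS; case: eqP => //= szs.
case: x => [|x] /=; first by rewrite andbF.
have -> : \sum_(1 <= j < d.+2) 'C(nth 0 (x.+1 :: s) j.-1, j)
          = (binsum (x :: s)).+1.
  rewrite /binsum big_add1 big_mkord /= szs !big_ord_recl /= !bin1 addSn.
  by congr (_ + _).+1.
congr (_ && _); case: s szs => [|y s] <- //=; congr (_ && _).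
rewrite /index_iota !subSS subn0 (iotaDl 2 0) all_map.
have -> : path ltn y s = all (fun i => nth 0 (y :: s) i < nth 0 s i)
                           (iota 0 (size s)).
  apply/(pathP 0)/allP => h i; first by rewrite mem_iota => /andP[_] /h.
  by move=> lti; apply: h; rewrite mem_iota.
by apply: eq_all => i.
Qed.

Lemma cascade_total d a : exists s, (0 < d) && (0 < a) ==> cascade d a s.
Proof.
case: d a => [|d] [|a]; try by exists [::].
have [|s [szs sums ss _]] := @binsum_exists d.+1 a (a + d.+1).
  elim: d => [|d IH]; first by rewrite bin1 addn1.
  by rewrite addnS binS; move: IH; lia.
case: s szs sums ss => [|x s] //= [szs] sums ss.
by exists (x.+1 :: s); rewrite /= cascade_lower /= szs sums ss !eqxx.
Qed.

Lemma cascade_uniq d a s t :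
  0 < d -> cascade d a s -> cascade d a t -> s = t.
Proof.
case: d => // d _; rewrite !cascade_lower.
case: s t => [|x s] [|y t] //=; try by rewrite ?andbF.
move=> /and4P[/eqP[szs] x0 /eqP -> Ss] /and4P[/eqP[szt] y0 /eqP[e] St].
have := @binsum_inj (x.-1 :: s) (y.-1 :: t) _ Ss St e.
  rewrite /= szs szt => /(_ erefl).
by case=> exy ->; congr (_ :: _); lia.
Qed.

(* The sequence [:: k_1; ...; k_d]; a junk value when d = 0 or a = 0. *)
Definition cascade_seq (d a : nat) : seq nat := xchoose (cascade_total d a).

Lemma cascade_seqP d a : 0 < d -> 0 < a -> cascade d a (cascade_seq d a).
Proof.
move=> d0 a0; apply: (implyP (xchooseP (cascade_total d a))).
by rewrite d0 a0.
Qed.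

(* The coefficient c_j, for 1 <= j <= d; as k_j >= j - 1, the subtraction does
   not truncate. *)
Definition fractal_coef (d a j : nat) : nat :=
  let k := nth 0 (cascade_seq d a) j.-1 in
  if j == 1 then k else k + 2 - j.

Local Open Scope ring_scope.

(** * Monomials *)

(* To have n >= 1 variables, the polynomial ring is {mpoly k[n.+1]}.  The
   variable x_c, 1 <= c <= n.+1, is 'X_i with i : 'I_n.+1 of value c - 1. *)
Definition Xmon (k : fieldType) (n d a : nat) : {mpoly k[n.+1]} :=
  \prod_(1 <= j < d.+1) 'X_(inord (fractal_coef d a j).-1).

(** * Ideals of the polynomial ring *)

Section Ideals.
Variables (k : fieldType) (n : nat).
Implicit Types (I J : {mpoly k[n.+1]} -> Prop).

Definition is_ideal I : Prop :=
  [/\ I 0, forall f g, I f -> I g -> I (f + g)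
    & forall f g, I g -> I (f * g)].

Definition ideal_gen (A : {mpoly k[n.+1]} -> Prop) (f : {mpoly k[n.+1]}) : Prop :=
  forall J, is_ideal J -> (forall g, A g -> J g) -> J f.

Definition monomial_ideal I : Prop :=
  is_ideal I /\
  exists G : 'X_{1..n.+1} -> Prop,
    forall f, I f <-> ideal_gen (fun g => exists2 m, G m & g = 'X_[m]) f.

(* Lexicographic order with x_1 < x_2 < ... : the exponents are compared from
   the last variable down (the order of the mpoly library does the opposite). *)
Definition lex_lt (u v : 'X_{1..n.+1}) : Prop :=
  exists i : 'I_n.+1,
    (u i < v i)%N /\ forall j : 'I_n.+1, (i < j)%N -> u j = v j.

Definition lex_segment_ideal I : Prop :=
  monomial_ideal I /\
  forall (d : nat) (u v : 'X_{1..n.+1}),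
    mdeg u = d -> mdeg v = d -> I 'X_[u] -> lex_lt u v -> I 'X_[v].

(* H_{S/I}(d) = h, where S_d is [dhomog n.+1 k d] and the subspace [U] is the
   homogeneous component I_d. *)
Definition hilbert_quotient I (d h : nat) : Prop :=
  exists2 U : {vspace dhomog n.+1 k d},
    (forall u : dhomog n.+1 k d, u \in U <-> I (mpoly_of_dhomog u)) &
    h = (\dim {:dhomog n.+1 k d} - \dim U)%N.

(** * The ideal of a fractal growth *)

Definition IT_comp (T : nat -> seq nat) (d : nat) (f : {mpoly k[n.+1]}) : Prop :=
  exists c : nat -> k,
    f = \sum_((size (T d)).+1 <= a < 'C(n.+1 + d - 1, d).+1) c a *: Xmon k n d a.

Definition IT (T : nat -> seq nat) (f : {mpoly k[n.+1]}) : Prop :=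
  exists (D : nat) (g : nat -> {mpoly k[n.+1]}),
    (forall d, IT_comp T d (g d)) /\ f = \sum_(d < D) g d.

End Ideals.

(* Main.v *)
(* The index a of X_a^(d), lowered by one, is the number of degree d monomials
   that are lex smaller: writing a monomial as x_{y_0+1} ... x_{y_(d-1)+1} with
   y weakly increasing, the cascade of a says a - 1 = sum_i 'C(y_i + i, i+1).
   Multiplying by x_1 prepends 0 to y.  In the untruncated growth of (n), the
   entry at position a is y_0 + 1, which counts the degree d+1 monomials whose
   quotient by their least variable is X_a; hence the first a - 1 entries expand
   to as many entries as there are monomials below x_1 X_a.  So X_a in I(T)
   forces x_1 X_a in I(T), and every other multiple x_i X_a is lex larger. *)
Require Import Defs.
From mathcomp Require Import all_boot all_order all_algebra zify.

Set Implicit Arguments.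
Unset Strict Implicit.
Unset Printing Implicit Defensive.

Import GRing.Theory.

(** * Ranks of weakly increasing sequences *)

(* The offset [o] stands for [o] leading zeros, whose terms 'C(i, i+1) vanish. *)
Fixpoint rank (o : nat) (s : seq nat) : nat :=
  if s is x :: s' then 'C(x + o, o.+1) + rank o.+1 s' else 0.

Lemma rank_rcons o s x :
  rank o (rcons s x) = rank o s + 'C(x + (o + size s), (o + size s).+1).
Proof.
elim: s o => [|y s IH] o /=; first by rewrite !addn0.
by rewrite IH addSnnS addnA.
Qed.

Lemma sorted_leq_rcons s x :
  sorted leq (rcons s x) = sorted leq s && all (geq x) s.
Proof.
rewrite -cats1 !(sorted_pairwise leq_trans) pairwise_cat /= allrel1r andbT.
by rewrite andbC.
Qed.

(** Split off the greatest entry x, with d entries before it: these have rank below 'C(x + d, d), so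
    Pascal's rule puts the total below 'C(x + d + 1, d + 1). *)
Lemma rank_lt s M : sorted leq s -> all (geq M) s ->
  rank 0 s < 'C(M + size s, size s).
Proof.
elim/last_ind: s M => [|s x IH] M; first by rewrite bin0.
rewrite sorted_leq_rcons all_rcons => /andP[ss sx] /= /andP[xM _].
rewrite rank_rcons size_rcons add0n.
have := IH _ ss sx.
have : 'C(x + (size s).+1, (size s).+1) <= 'C(M + (size s).+1, (size s).+1).
  by apply: leq_bin2l; rewrite leq_add2r.
rewrite addnS binS; lia.
Qed.

Lemma count_mem_rcons (T : eqType) (s : seq T) x y :
  count_mem y (rcons s x) = count_mem y s + (x == y).
Proof. by rewrite -cats1 count_cat /= addn0. Qed.

(** Compare the greatest entries [x] and [y]. If they agree, both are dropped; if [x < y], the term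
    of [y] alone exceeds the rank of the whole first sequence, by [rank_lt]. *)
Lemma rank_lt_lex s t i : sorted leq s -> sorted leq t -> size s = size t ->
  count_mem i s < count_mem i t ->
  (forall j, i < j -> count_mem j s = count_mem j t) ->
  rank 0 s < rank 0 t.
Proof.
elim/last_ind: s t => [|s x IH] t; first by case: t.
case/lastP: t => [|t y]; first by rewrite size_rcons.
rewrite !size_rcons !sorted_leq_rcons => /andP[ss sx] /andP[st ty] [est].
rewrite !count_mem_rcons => ci cj; rewrite !rank_rcons est !add0n.
case: (ltngtP x y) => [ltxy|ltyx|exy].
- have := rank_lt ss sx; rewrite est.
  have : 'C(x + (size t).+1, (size t).+1) <= 'C(y + size t, (size t).+1).
    by apply: leq_bin2l; lia.
  rewrite addnS binS; lia.
(* The case [y < x] is impossible: [i] occurs in the second sequence, so [i <= y < x], and the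
   counts of [x] would have to agree although [x] does not occur there. *)
- have t0 j : y < j -> count_mem j t = 0.
    move=> ltyj; apply/count_memPn/negP => /(allP ty) /=; lia.
  have {ci} leiy : i <= y.
    rewrite leqNgt; apply/negP => ltyi; move: ci; rewrite t0 //.
    by case: (y =P i) ltyi; lia.
  have := cj x (leq_ltn_trans leiy ltyx).
  by rewrite !count_mem_rcons t0 // eqxx; case: eqP; lia.
- rewrite exy ltn_add2r; apply: IH => //; first by move: ci; rewrite exy; lia.
  by move=> j /cj; rewrite !count_mem_rcons exy; lia.
Qed.

(** Greedy choice: the bound on the entries is lowered while [N] allows it; otherwise the last entry
    is the bound itself, and Pascal's rule controls the remainder. *)
Lemma rank_exists d N M : N < 'C(M + d, d) ->
  exists s, [/\ size s = d, sorted leq s, all (geq M) s & rank 0 s = N].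
Proof.
elim: d N M => [|d IHd] N M.
  by rewrite bin0 ltnS leqn0 => /eqP ->; exists [::].
elim: M => [|M IHM]; last case: (ltnP N 'C(M + d.+1, d.+1)).
- rewrite add0n binn => N1; exists (nseq d.+1 0).
  have [-> rk0] : N = 0 /\ forall o k, rank o (nseq k 0) = 0; first split; first lia.
    by move=> o k; elim: k o => //= k IH o; rewrite add0n bin_small ?IH.
  split; rewrite ?size_nseq ?rk0 ?all_nseq //.
  by elim: d {IHd} => //= d /= ->.
- move=> /IHM[s [szs ss sM rs]]; exists s; split => //.
  by apply: sub_all sM => x /=; lia.
- move=> leN ltN; case: (IHd (N - 'C(M.+1 + d, d.+1)) M.+1).
    by move: ltN leN; rewrite !addSnnS !addnS binS; lia.
  move=> s [szs ss sM rs]; exists (rcons s M.+1); split.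
  + by rewrite size_rcons szs.
  + by rewrite sorted_leq_rcons ss.
  + by rewrite all_rcons /= leqnn.
  + by rewrite rank_rcons rs szs add0n subnK // addSnnS.
Qed.

(** * Iterated expansions and the untruncated growth *)

Lemma expansion1 a : expansion [:: a] = iota 1 a.
Proof. exact: cats0. Qed.

Lemma expansion_cat s t : expansion (s ++ t) = expansion s ++ expansion t.
Proof. by rewrite /expansion map_cat flatten_cat. Qed.

Lemma iter_expansion_cat i s t :
  iter i expansion (s ++ t) = iter i expansion s ++ iter i expansion t.
Proof. by elim: i => //= i ->; rewrite expansion_cat. Qed.

Lemma iter_expansion_nil i : iter i expansion [::] = [::].
Proof. by elim: i => //= i ->. Qed.

(** Pascal's rule: the last entry [y.+1] of [iota 1 y.+1] expands to that same list, so it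
    contributes the count for one iteration less. *)
Lemma size_iter_expansion_iota i y :
  size (iter i expansion (iota 1 y)) = 'C(y + i, i.+1).
Proof.
elim: i y => [|i IHi] y; first by rewrite size_iota addn0 bin1.
elim: y => [|y IHy].
  by rewrite add0n bin_small // iter_expansion_nil.
rewrite -[X in iota _ X]addn1 iotaD iter_expansion_cat size_cat IHy.
by rewrite -[iota _ 1]/[:: y.+1] iterSr expansion1 IHi addSnnS [in RHS]addSn binS.
Qed.

Definition full_growth (n d : nat) : seq nat := iter d expansion [:: n.+1].

Lemma size_full_growth n d : size (full_growth n d) = 'C(n + d, d).
Proof.
case: d => [|d]; first by rewrite bin0.
by rewrite /full_growth iterSr expansion1 size_iter_expansion_iota addSnnS.
Qed.

(* [P] consists of the entries indexed by the monomials lex smaller than [y]. *)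
Lemma full_growth_split n y : sorted leq y -> all (geq n) y ->
  exists P Q, full_growth n (size y) = P ++ (head n y).+1 :: Q
    /\ forall i, size (iter i expansion P) = rank i y.
Proof.
elim: y => [|x y IH] /=.
  by exists [::], [::]; split=> // i; rewrite iter_expansion_nil.
move=> sxy /andP[xn yn]; have [P [Q [eE szP]]] := IH (path_sorted sxy) yn.
(* For empty [y] the default [n] of [head] matches the root entry [n.+1]. *)
have lex : x <= head n y by case: (y) sxy => //= z t /andP[].
(* The entry [(head n y).+1] expands to a list that contains [x.+1]. Cutting there adds [iota 1 x]
   to the left part, which accounts for the first binomial of [rank i (x :: y)]. *)
exists (expansion P ++ iota 1 x), (iota x.+2 (head n y - x) ++ expansion Q).
split=> [|i]; last first.
  by rewrite iter_expansion_cat size_cat size_iter_expansion_iota -iterSr szP addnC.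
rewrite eE -cat1s !expansion_cat expansion1.
by rewrite -{1}(subnKC lex) -addnS iotaD /= add1n -!catA /=.
Qed.

Lemma prefix_expansion s t : prefix s t -> prefix (expansion s) (expansion t).
Proof. by case/prefixP => u ->; rewrite expansion_cat prefix_prefix. Qed.

Lemma coherent_prefix n T d :
  coherent_fractal_growth n.+1 T -> prefix (T d) (full_growth n d).
Proof.
move=> [T0 TS]; elim: d => [|d IH]; first by rewrite T0 prefix_refl.
exact: prefix_trans (TS d) (prefix_expansion IH).
Qed.

(** If [T (size y)] ends within [P], its expansion ends within that of [P], whose size is
    [rank 1 y], the rank of [0 :: y]. In terms of ranks, this is closure under multiplication by
    x_1. *)
Lemma coherent_rank n T y : coherent_fractal_growth n.+1 T ->
  sorted leq y -> all (geq n) y ->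
  size (T (size y)) <= rank 0 y -> size (T (size y).+1) <= rank 1 y.
Proof.
move=> hT sy yn; have [P [Q [eE szP]]] := full_growth_split sy yn.
rewrite -!szP => leTP; apply: (@leq_trans (size (expansion (T (size y))))).
  by case: hT => _ /(_ (size y)) /size_prefix.
apply/size_prefix/prefix_expansion.
have := coherent_prefix (size y) hT.
by rewrite eE prefixE takel_cat // -prefixE.
Qed.

(** * Monomials as sequences of variable indices *)

Section Exponents.
Variable n : nat.
Implicit Types (m u v : 'X_{1..n.+1}) (i j : 'I_n.+1).

(** The variables of [m], numbered from 0 and repeated with multiplicity, in weakly increasing
    order. *)
Definition exps m : seq nat := [seq val i | i <- m2s m].

Definition mrank m : nat := rank 0 (exps m).

Lemma size_exps m : size (exps m) = mdeg m.
Proof. by rewrite size_map size_m2s. Qed.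

Lemma sorted_exps m : sorted leq (exps m).
Proof. exact: srt_m2s. Qed.

Lemma exps_le m : all (geq n) (exps m).
Proof. by rewrite all_map; apply/allP => i _ /=; rewrite -ltnS. Qed.

Lemma count_exps m i : count_mem (val i) (exps m) = m i.
Proof.
rewrite count_map -[in RHS](s2mK m) mnmE.
by apply: eq_count => j /=; rewrite val_eqE.
Qed.

Lemma exps_s2m y : sorted leq y -> all (geq n) y ->
  exps (s2m [seq inord x | x <- y] : 'X_{1..n.+1}) = y.
Proof.
move=> sy yn; have ey : [seq val i | i <- [seq inord x : 'I_n.+1 | x <- y]] = y.
  rewrite -map_comp -[RHS]map_id; apply/eq_in_map => x /(allP yn) /= xn.
  by rewrite inordK.
(* Both sides are sorted, so it suffices to compare multiplicities. *)
rewrite -[RHS]ey; apply: (sorted_eq leq_trans anti_leq); rewrite ?ey ?sorted_exps //.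
rewrite -[X in perm_eq _ X]ey; apply/perm_map/allP => i _ /=; apply/eqP.
set s := map inord y; have := congr1 (fun m : 'X_{1..n.+1} => m i) (s2mK (s2m s)).
by rewrite !mnmE.
Qed.

Lemma mrank_lt_lex u v : mdeg u = mdeg v -> lex_lt u v -> mrank u < mrank v.
Proof.
move=> euv [i [lti eqj]]; apply: (@rank_lt_lex _ _ (val i)); rewrite ?sorted_exps //.
- by rewrite !size_exps.
- by rewrite !count_exps.
- move=> j ltij; case: (ltnP j n.+1) => [ltj|lejn].
    by rewrite -[j]/(val (Ordinal ltj)) !count_exps eqj.
  have exps0 m : count_mem j (exps m) = 0.
    by apply/count_memPn/negP => /(allP (exps_le m)) /=; lia.
  by rewrite !exps0.
Qed.

Lemma exps_addU0 m : exps (U_(ord0) + m)%MM = 0 :: exps m.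
Proof.
rewrite /exps /m2s enum_ordSl /= !mnmDE mnm1E eqxx add1n /= !map_cat.
congr (_ :: _ ++ _); congr (map _ (flatten _)); rewrite -!map_comp.
by apply: eq_map => j /=; rewrite mnmDE mnm1E.
Qed.

(** Among the products of [m] with one variable, the one with x_1 is lex least, and its rank is
    exactly [rank 1 (exps m)]. *)
Lemma mrank_addU m i : rank 1 (exps m) <= mrank (U_(i) + m)%MM.
Proof.
have -> : rank 1 (exps m) = mrank (U_(ord0) + m)%MM by rewrite /mrank exps_addU0.
case: (eqVneq i ord0) => [-> //|i0]; apply/ltnW/mrank_lt_lex.
  by rewrite !mdegD !mdeg1.
exists i; split=> [|j ltij]; first by rewrite !mnmDE !mnm1E eqxx eq_sym (negbTE i0).
rewrite !mnmDE !mnm1E; case: eqP => [ej|_]; first by rewrite -ej in ltij.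
by case: eqP => // ej; rewrite -ej ltnn in ltij.
Qed.

Lemma mrank_exists d N : N < 'C(n + d, d) ->
  exists2 m, mdeg m = d & mrank m = N.
Proof.
case/rank_exists => y [szy sy yn ry].
by exists (s2m [seq inord x | x <- y]); rewrite /mrank -?size_exps exps_s2m.
Qed.

End Exponents.

Local Open Scope ring_scope.

(** * Fractal coefficients of a rank *)

Section FractalMonomials.
Variables (k : fieldType) (n : nat).
Implicit Types (m : 'X_{1..n.+1}).

Lemma mpolyX_m2s m : 'X_[m] = \prod_(i <- m2s m) 'X_i :> {mpoly k[n.+1]}.
Proof.
rewrite -[in LHS](s2mK m); elim: (m2s m) => [|i s IH].
  by rewrite big_nil -mpolyX0; congr 'X_[_]; apply/mnmP => i; rewrite mnmE mnm0E.
rewrite big_cons -IH -mpolyXD; congr 'X_[_]; apply/mnmP => j.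
by rewrite mnmDE mnm1E !mnmE.
Qed.

Lemma binsum_shift y :
  binsum (mkseq (fun i => nth 0 y i + i)%N (size y)) = rank 0 y.
Proof.
elim/last_ind: y => [|y x IH]; first by rewrite /binsum big_ord0.
rewrite rank_rcons size_rcons /mkseq -addn1 iotaD map_cat cats1 binsum_rcons.
rewrite size_map size_iota add0n addn1 /= nth_rcons ltnn eqxx; congr (_ + _)%N.
rewrite -IH; congr binsum; apply/eq_in_map => i; rewrite mem_iota => /andP[_ lti].
by rewrite nth_rcons lti.
Qed.

(** The shift by [i] makes the sequence strictly increasing. The summand [(i == 0)] raises k_1,
    hence 'C(k_1, 1), by one, which undoes the lowering in [cascade_lower]. *)
Lemma cascade_rank y : y != [::] -> sorted leq y ->
  cascade (size y) (rank 0 y).+1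
    [seq nth 0 y i + i + (i == 0) | i <- iota 0 (size y)]%N.
Proof.
case: y => // x y _ sxy; rewrite cascade_lower /= size_map size_iota eqxx /=.
rewrite !addn0 addn1 /=.
set t := _ :: _.
have et : t = mkseq (fun i => nth 0 (x :: y) i + i)%N (size y).+1.
  rewrite /t /mkseq /= addn0; congr (_ :: _); apply/eq_in_map => i.
  by rewrite mem_iota; case: i => //= i _; rewrite addn0.
rewrite -[path ltn x _]/(sorted ltn t) et (binsum_shift (x :: y)).
rewrite [rank 0 (x :: y)]/= addn0 eqxx andTb.
apply/(sortedP 0%N) => i; rewrite size_mkseq => lti.
rewrite !nth_mkseq ?(ltnW lti) //= addnS ltnS leq_add2r.
by apply: (pathP 0%N sxy).
Qed.

(** By uniqueness of the cascade, k_1 = y_0 + 1 and k_j = y_(j-1) + j - 1 for j >= 2; both cases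
    give c_j = y_(j-1) + 1. *)
Lemma fractal_coef_rank y j : sorted leq y -> (0 < j <= size y)%N ->
  fractal_coef (size y) (rank 0 y).+1 j = (nth 0%N y j.-1).+1.
Proof.
move=> sy /andP[j0 jy]; have y0 : y != [::] by case: (y) jy j0 => //=; case: j.
have szy : (0 < size y)%N by apply: leq_trans jy.
rewrite /fractal_coef (cascade_uniq szy (cascade_seqP szy _) (cascade_rank y0 sy)) //.
rewrite (nth_map 0%N) ?size_iota ?prednK // nth_iota ?prednK // add0n.
by case: j j0 {jy} => [|[|j]] //= _; lia.
Qed.

Lemma Xmon_mrank m : Xmon k n (mdeg m) (mrank m).+1 = 'X_[m].
Proof.
rewrite mpolyX_m2s /Xmon (big_nth ord0) big_add1 size_m2s /=.
apply: eq_big_nat => i /andP[_ lti]; congr 'X_(_).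
rewrite -size_exps fractal_coef_rank ?sorted_exps ?size_exps //.
by rewrite /= (nth_map ord0) ?size_m2s // inord_val.
Qed.

End FractalMonomials.

(** * The ideal I(T) and its monomials *)

Section FractalIdeal.
Variables (k : fieldType) (n : nat).
Implicit Types (f g : {mpoly k[n.+1]}) (m : 'X_{1..n.+1}).

Definition msupp_in (P : 'X_{1..n.+1} -> Prop) f : Prop :=
  forall m, m \in msupp f -> P m.

Lemma msupp_in_sum P (A : eqType) (r : seq A) (F : A -> {mpoly k[n.+1]}) :
  (forall a, a \in r -> msupp_in P (F a)) -> msupp_in P (\sum_(a <- r) F a).
Proof.
rewrite big_seq => PF; apply: big_ind => // [m|g h Pg Ph m].
  by rewrite msupp0.
by move=> /msuppD_le; rewrite mem_cat => /orP[/Pg|/Ph].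
Qed.

Lemma msupp_inZ P c f : msupp_in P f -> msupp_in P (c *: f).
Proof. by move=> Pf m /msuppZ_le /Pf. Qed.

Lemma XmonP d a : (0 < a <= 'C(n + d, d))%N ->
  exists m, [/\ mdeg m = d, (mrank m).+1 = a & Xmon k n d a = 'X_[m]].
Proof.
case: a => // a /andP[_ /mrank_exists[m dm rm]].
by exists m; rewrite -dm -rm Xmon_mrank.
Qed.

Lemma mrank_lt m : (mrank m < 'C(n + mdeg m, mdeg m))%N.
Proof. by rewrite -size_exps rank_lt ?sorted_exps ?exps_le. Qed.

Variable T : nat -> seq nat.

(** The index of a monomial is its rank plus one, so the strict bound on the index becomes a weak
    one on the rank. *)
Definition mon_IT m : Prop := (size (T (mdeg m)) <= mrank m)%N.

Lemma IT_compX m : mon_IT m -> IT_comp T (mdeg m) ('X_[m] : {mpoly k[n.+1]}).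
Proof.
move=> Tm; exists (fun a => (a == (mrank m).+1)%:R).
rewrite (bigD1_seq (mrank m).+1) ?iota_uniq //=; last first.
  by rewrite mem_index_iota !ltnS addSn subn1 mrank_lt andbT.
rewrite eqxx scale1r Xmon_mrank big1 ?addr0 // => a /negbTE ->.
by rewrite scale0r.
Qed.

Lemma IT_comp_sum d (A : eqType) (r : seq A) (F : A -> {mpoly k[n.+1]}) c :
  (forall a, a \in r -> IT_comp T d (F a)) ->
  IT_comp T d (\sum_(a <- r) c a *: F a).
Proof.
rewrite big_seq => TF; apply: big_ind => [|g h [cg ->] [ch ->]|a /TF [ca ->]].
- by exists (fun=> 0); rewrite big1 // => a _; rewrite scale0r.
- exists (fun a => cg a + ch a); rewrite -big_split.
  by apply: eq_bigr => a _; rewrite scalerDl.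
- exists (fun b => c a * ca b); rewrite scaler_sumr.
  by apply: eq_bigr => b _; rewrite scalerA.
Qed.

Lemma IT_comp_supp d f : IT_comp T d f -> msupp_in mon_IT f.
Proof.
case=> c ->; apply: msupp_in_sum => a; rewrite mem_index_iota => /andP[lea lta].
apply: msupp_inZ; have [|m [dm rm ->]] := @XmonP d a.
  by rewrite (leq_trans _ lea) //= -ltnS; move: lta; rewrite addSn subn1.
by move=> m' /mem_msuppXP <-; rewrite /mon_IT dm -ltnS rm.
Qed.

(** Membership is read off the support, which turns the ideal and lex segment properties into
    statements about ranks. *)
Lemma IT_msuppP f : IT T f <-> msupp_in mon_IT f.
Proof.
split=> [[D [g [Tg ->]]]|Tf].
  by apply: msupp_in_sum => d _; apply: IT_comp_supp (Tg d).
(* The homogeneous components of [f] vanish from degree [msize f] on. *)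
exists (msize f), (fun d => pihomog mdeg d f); split; last first.
  exact: pihomog_partitionE.
move=> d; rewrite pihomogE -big_filter; apply: IT_comp_sum => m.
by rewrite mem_filter => /andP[/eqP <- /Tf]; apply: IT_compX.
Qed.

Hypothesis hT : coherent_fractal_growth n.+1 T.

Lemma mon_IT_addl m m' : mon_IT m -> mon_IT (m' + m)%MM.
Proof.
(* Writing [m'] as a sum of unit exponents reduces the claim to multiplication by a single
   variable. *)
move=> Tm; rewrite [m']multinomUE_id.
elim/big_ind: _ m Tm => [m|u v IHu IHv m /IHv/IHu|i _ m].
- by rewrite add0m.
- by rewrite addmA.
elim: (m' i) m => [|e IH] m Tm; first by rewrite mulm0n add0m.
rewrite mulmS -addmA; move: (IH m Tm); set w := (_ + _)%MM => Tw.
apply: leq_trans (mrank_addU w i); rewrite mdegD mdeg1 add1n.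
move: Tw; rewrite /mon_IT -size_exps => Tw.
exact: coherent_rank hT (sorted_exps w) (exps_le w) Tw.
Qed.

Lemma IT_ideal : is_ideal (@IT k n T).
Proof.
split=> [|f g /IT_msuppP Tf /IT_msuppP Tg|f g /IT_msuppP Tg]; apply/IT_msuppP.
- by move=> m; rewrite msupp0.
- by move=> m /msuppD_le; rewrite mem_cat => /orP[/Tf|/Tg].
- by move=> m /msuppM_le /allpairsP[[m1 m2] [_ /Tg ? ->]]; apply: mon_IT_addl.
Qed.

Lemma IT_monomial_ideal : monomial_ideal (@IT k n T).
Proof.
split; first exact: IT_ideal.
exists mon_IT => f; split=> [/IT_msuppP Tf J [J0 JD JM] JG|]; last first.
  apply=> [|g [m Tm ->]]; first exact: IT_ideal.
  by apply/IT_msuppP => m' /mem_msuppXP <-.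
rewrite (mpolyE f) big_seq; apply: big_ind => // m /Tf Tm.
by rewrite -mul_mpolyC; apply: JM; apply: JG; exists m.
Qed.

Lemma IT_lex_segment : lex_segment_ideal (@IT k n T).
Proof.
split; first exact: IT_monomial_ideal.
move=> d u v du dv /IT_msuppP Tu ltuv; apply/IT_msuppP => m /mem_msuppXP <-.
have /Tu : u \in msupp ('X_[u] : {mpoly k[n.+1]}) by rewrite msuppX inE.
rewrite /mon_IT du dv => /leq_trans; apply; apply/ltnW/mrank_lt_lex => //.
by rewrite du.
Qed.

(** * The Hilbert function *)

(** For indices in this range [Xmon k n d a] is a monomial of degree [d], so [indhomog] never falls
    back on its default value. *)
Definition Xtail (d t : nat) : seq (dhomog n.+1 k d) :=
  [seq indhomog d (Xmon k n d a) | a <- iota t.+1 ('C(n + d, d) - t)].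

Lemma size_Xtail d t : size (Xtail d t) = ('C(n + d, d) - t)%N.
Proof. by rewrite size_map size_iota. Qed.

Lemma Xtail_drop d t : Xtail d t = drop t (Xtail d 0).
Proof. by rewrite -map_drop drop_iota subn0. Qed.

Lemma mpoly_of_indhomog d m : mdeg m = d ->
  mpoly_of_dhomog (indhomog d 'X_[m] : dhomog n.+1 k d) = 'X_[m].
Proof. by move=> dm; rewrite -[LHS]/(val _) val_insubd dhomogX /= dm eqxx. Qed.

Lemma span_XtailP d t (u : dhomog n.+1 k d) :
  u \in <<Xtail d t>>%VS <->
  msupp_in (fun m => t <= mrank m)%N (mpoly_of_dhomog u).
Proof.
split=> [|tu].
  rewrite -[Xtail d t]/(tval (in_tuple _)) => /coord_span ->; rewrite linear_sum.
  apply: msupp_in_sum => i _; rewrite linearZ; apply: msupp_inZ.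
  rewrite (nth_map 0%N) ?size_iota -?(size_Xtail d t) //.
  have lti : (i < 'C(n + d, d) - t)%N by rewrite -(size_Xtail d t).
  rewrite nth_iota //; have [|m [dm rm ->]] := @XmonP d (t.+1 + i); first by lia.
  by rewrite /= mpoly_of_indhomog // => m' /mem_msuppXP <-; lia.
(* Each monomial of [u] is X_a for a = [(mrank m).+1], hence a member of the tail. *)
have -> : u = \sum_(m <- msupp (mpoly_of_dhomog u))
                 (mpoly_of_dhomog u)@_m *: indhomog d 'X_[m].
  apply/val_inj; rewrite /= linear_sum [LHS]mpolyE big_seq [RHS]big_seq.
  apply: eq_bigr => m mu; rewrite linearZ /= mpoly_of_indhomog //.
  exact: (dhomog_mf (dhomog_is_dhomog u)).
rewrite big_seq; apply: rpred_sum => m mu; apply/rpredZ/memv_span/mapP.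
have dm : mdeg m = d by apply: (dhomog_mf (dhomog_is_dhomog u)).
exists (mrank m).+1; last by rewrite -dm Xmon_mrank.
by have := tu m mu; have := mrank_lt m; rewrite mem_iota dm; lia.
Qed.

(** All the X_a together span a space whose dimension is their number, so they are free, and so is
    every tail. *)
Lemma dim_span_Xtail d t :
  \dim <<Xtail d t>> = ('C(n + d, d) - t)%N.
Proof.
rewrite -size_Xtail; apply/eqP; rewrite -[_ == _]/(free _).
rewrite Xtail_drop; apply: (@catr_free _ _ (take t (Xtail d 0))).
rewrite cat_take_drop /free size_Xtail subn0.
have -> : <<Xtail d 0>>%VS = fullv.
  by apply/vspaceP => u; rewrite memvf; apply/span_XtailP.
by rewrite dimvf addnC.
Qed.

Lemma IT_hilbert d : hilbert_quotient (@IT k n T) d (size (T d)).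
Proof.
(* This bound ensures that subtracting the codimension in natural numbers gives back
   [size (T d)]. *)
have leTC : (size (T d) <= 'C(n + d, d))%N.
  by rewrite -size_full_growth; apply/size_prefix/coherent_prefix.
exists <<Xtail d (size (T d))>>%VS.
  move=> u; rewrite span_XtailP IT_msuppP.
  have du := dhomog_mf (dhomog_is_dhomog u).
  by split=> Tu m mu; move: (Tu m mu); rewrite /mon_IT (du m mu).
rewrite dim_span_Xtail // dimvf [dim _]/= [X in (X - _)%N](_ : _ = 'C(n + d, d)).
  by rewrite subKn.
by rewrite addnC.
Qed.

End FractalIdeal.

Theorem proposition3p2 (k : fieldType) (n : nat) (T : nat -> seq nat)
  (hT : coherent_fractal_growth n.+1 T) :
  lex_segment_ideal (@IT k n T) /\
  forall d : nat, hilbert_quotient (@IT k n T) d (size (T d)).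
Proof. by split=> [|d]; [exact: IT_lex_segment | exact: IT_hilbert]. Qed.
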